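(* Let $n\ge2$ be an integer and consider the $n$-player quantum volunteer's dilemma $G^{(n)}_{\mathrm{QVD}}$. Let $Q=\left(0,\frac{\pi}{n}\right)\in\Theta$ and let $Q^n=(Q,Q,\ldots,Q)\in\Theta^n$. If the players adopt the strategy profile $Q^n$, then every player volunteers with probability $1$, i.e. $p_{Q^n}(x)=[x=1^n]$ for all $x\in\{0,1\}^n$, and the corresponding payoff of each player $a\in[n]$ is $$\$_a(Q^n)=2-\frac1n.$$ Moreover, (a) if $2\le n\le 9$, then $Q^n$ is a Nash equilibrium of $G^{(n)}_{\mathrm{QVD}}$; and (b) if $n\ge10$, then $Q^n$ is not a Nash equilibrium of $G^{(n)}_{\mathrm{QVD}}$.
   Context: Notation: $[n]=\{1,\ldots,n\}$; $[P]$ is the Iverson bracket, equal to $1$ if $P$ is true and $0$ otherwise. For $x\in\{0,1\}^n$, $\mathrm{wt}(x)=|\{i\in[n]:x_i=1\}|$ is the Hamming weight, $\bar x$ is the bitwise complement ($\bar x_i=1-x_i$), and $1^n$ is the all-ones string. Deterministic volunteer's dilemma payoffs: for $x\in\{0,1\}^n$ ($x_i=1$ means player $i$ volunteers, $x_i=0$ means player $i$ abstains), $\$_i^{\mathrm{VD}}(x)=2-\frac1{\mathrm{wt}(x)}$ if $x_i=1$, and $\$_i^{\mathrm{VD}}(x)=2\,[\mathrm{wt}(x)>0]$ if $x_i=0$. Quantum volunteer's dilemma $G^{(n)}_{\mathrm{QVD}}$: the $n$-player game in which every player's strategy set is $\Theta=[0,4\pi)\times[0,2\pi)$. Strategy $(\theta_i,\phi_i)\in\Theta$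 means that player $i$ applies to qubit $i$ the unitary $$U(\theta_i,\phi_i)=\begin{pmatrix}e^{\mathrm i\phi_i}\cos(\theta_i/2)&\sin(\theta_i/2)\\-\sin(\theta_i/2)&e^{-\mathrm i\phi_i}\cos(\theta_i/2)\end{pmatrix}.$$ Let $J=e^{-\frac{\mathrm i\pi}{4}Y^{\otimes n}}=\frac1{\sqrt2}(I-\mathrm iY^{\otimes n})$ with $Y=\begin{pmatrix}0&-\mathrm i\\\mathrm i&0\end{pmatrix}$, and let $|x\rangle$, $x\in\{0,1\}^n$, be the computational basis of $(\mathbb C^2)^{\otimes n}$. For a strategy profile $(\theta,\phi)=((\theta_1,\phi_1),\ldots,(\theta_n,\phi_n))\in\Theta^n$ and $x\in\{0,1\}^n$, the probability that exactly the players $i$ with $x_i=1$ volunteer is $$p_{\theta,\phi}(x)=\left|\langle\bar x|J^\dagger\Big(\bigotimes_{j=1}^nU(\theta_j,\phi_j)\Big)J|0\rangle^{\otimes n}\right|^2,$$ and the payoff function of player $i$ is $\$_i(\theta,\phi)=\sum_{x\in\{0,1\}^n}\$_i^{\mathrm{VD}}(x)\,p_{\theta,\phi}(x)$. For a profile $s=(\theta,\phi)$ write $p_s=p_{\theta,\phi}$ and $\$_i(s)=\$_i(\theta,\phi)$. Nash equilibrium: a profile $s=(s_1,\ldots,s_n)\in\Theta^n$ is a Nash equilibrium if for every player $i$ and every $t_i\in\Theta\setminus\{s_i\}$, $\$_i(s_1,\ldots,s_{i-1},s_i,s_{i+1},\ldots,s_n)\ge\$_i(s_1,\ldots,s_{i-1},t_i,s_{i+1},\ldots,s_n)$.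 *)

(* Defs.v *)
From HB Require Import structures.
From mathcomp Require Import all_boot all_order all_algebra.
From mathcomp Require Import spectral.
From mathcomp Require Import complex.
From mathcomp Require Import classical_sets set_interval reals trigo.

Set Implicit Arguments.
Unset Strict Implicit.
Unset Printing Implicit Defensive.

Import Order.TTheory GRing.Theory Num.Theory.

Local Open Scope ring_scope.
Local Open Scope complex_scope.
Local Open Scope sesquilinear_scope.

(* Players are 0-based: player i of 'I_n is player i + 1 of [n]. *)
Definition bits (n : nat) := {ffun 'I_n -> 'I_2}.

Definition wt n (x : bits n) : nat := #|[set i | x i == 1]%SET|.

Definition all_zeros n : bits n := [ffun=> 0].
Definition all_ones n : bits n := [ffun=> 1].

(* On 'I_2, rev_ord b is 1 - b. *)
Definition bitcompl n (x : bits n) : bits n := [ffun i => rev_ord (x i)].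

(* If x i = 1 then wt x > 0, so no division by zero occurs. *)
Definition vd_payoff (R : realType) n (i : 'I_n) (x : bits n) : R :=
  if x i == 1 then 2 - (wt x)%:R^-1 else 2 * (0 < wt x)%N%:R.

(* Operators and vectors on the n-fold tensor power of C^2 are matrices indexed
   by the computational basis, via the bijection enum_rank / bits_of between
   [bits n] and 'I_#|bits n|. *)
Definition bits_of n (k : 'I_#|bits n|) : bits n := enum_val k.

Section Qubits.
Variable R : realType.
Local Notation C := R[i].

Definition mx22 (a b c d : C) : 'M[C]_2 :=
  \matrix_(i, j) if i == 0 then (if j == 0 then a else b)
                 else (if j == 0 then c else d).

Definition expi (t : R) : C := cos t +i* sin t.

Definition ket n (x : bits n) : 'cV[C]_#|bits n| := delta_mx (enum_rank x) 0.

Definition bra n (x : bits n) : 'rV[C]_#|bits n| := (ket x)^t*.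

Definition tensor n (A : 'I_n -> 'M[C]_2) : 'M[C]_#|bits n| :=
  \matrix_(a, b) \prod_(j < n) A j (bits_of a j) (bits_of b j).

Definition pauliY : 'M[C]_2 := mx22 0 (- 'i) 'i 0.

(* This is exp(- i (pi / 4) Y^{(x) n}), because Y^{(x) n} squares to 1. *)
Definition entangler n : 'M[C]_#|bits n| :=
  ((Num.sqrt 2)^-1)%:C *: (1%:M - 'i *: tensor (fun _ : 'I_n => pauliY)).

Definition strategy : Type := (R * R)%type.

Definition Theta : set strategy :=
  [set s | 0 <= s.1 < 4 * pi /\ 0 <= s.2 < 2 * pi]%classic.

Definition profile (n : nat) := 'I_n -> strategy.

Definition gate (s : strategy) : 'M[C]_2 :=
  mx22 (expi s.2 * (cos (s.1 / 2))%:C) (sin (s.1 / 2))%:C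
       (- (sin (s.1 / 2))%:C) (expi (- s.2) * (cos (s.1 / 2))%:C).

Definition amplitude n (s : profile n) (y : bits n) : C :=
  (bra y *m (entangler n)^t* *m tensor (fun j => gate (s j))
     *m entangler n *m ket (all_zeros n)) 0 0.

(* The probability that exactly the players i with x i = 1 volunteer: an
   outcome 0 of qubit i means that player i volunteers. *)
Definition outcome_prob n (s : profile n) (x : bits n) : R :=
  Normc.normc (amplitude s (bitcompl x)) ^+ 2.

Definition payoff n (i : 'I_n) (s : profile n) : R :=
  \sum_(x : bits n) vd_payoff R i x * outcome_prob s x.

Definition deviate n (s : profile n) (i : 'I_n) (t : strategy) : profile n :=
  [eta s with i |-> t].

Definition is_Nash n (s : profile n) : Prop :=
  (forall i, Theta (s i)) /\
  forall (i : 'I_n) (t : strategy), Theta t -> t <> s i ->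
    payoff i s >= payoff i (deviate s i t).

Definition Qstrat (n : nat) : strategy := (0, pi / n%:R).

Definition Qprofile (n : nat) : profile n := fun=> Qstrat n.

End Qubits.

Arguments Qprofile R n _ : clear implicits.

(* Main.v *)
(** For single-qubit gates in SU(2), conjugation by the Pauli matrix Y is entrywise
    complex conjugation, so the amplitude of |y> is Re z + i^n Im w, where z and w
    are the entries of the product gate from |0...0> and from |1...1> to |y>.
    If all players but one play Q, their gates are diagonal and only four
    outcomes survive; the deviator playing (theta, phi) gets
      cos^2(theta/2) (2 - 1/n) cos^2(phi - pi/n) + sin^2(theta/2) (1 + cos^2(pi/n)).
    Hence Q^n is a Nash equilibrium iff 1/n <= sin^2(pi/n).  For n <= 9 this follows
    from the values at pi/4, pi/6, pi/8 and pi/9 and monotonicity; for n >= 10 it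
    fails because sin x <= x and pi^2 < 10. *)

Require Import Defs.
From HB Require Import structures.
From mathcomp Require Import all_boot all_order all_algebra.
From mathcomp Require Import complex classical_sets reals trigo.
From mathcomp Require Import ring lra.
From mathcomp Require Import functions topology normedtype derive.

Set Implicit Arguments.
Unset Strict Implicit.
Unset Printing Implicit Defensive.

Import Order.TTheory GRing.Theory Num.Theory.
Import numFieldNormedType.Exports.
Local Open Scope ring_scope.

(** * Bits and complements of bit strings *)

Lemma ord2_ind (P : 'I_2 -> Prop) : P 0 -> P 1 -> forall b, P b.
Proof.
move=> P0 P1 [[|[|//]] lt_b].
- by rewrite (_ : Ordinal _ = 0) //; apply: val_inj.
- by rewrite (_ : Ordinal _ = 1) //; apply: val_inj.
Qed.

Lemma rev_ord2_0 : rev_ord (0 : 'I_2) = 1. Proof. exact: val_inj. Qed.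
Lemma rev_ord2_1 : rev_ord (1 : 'I_2) = 0. Proof. exact: val_inj. Qed.

Lemma bitcomplK n : involutive (@bitcompl n).
Proof. by move=> x; apply/ffunP => i; rewrite !ffunE rev_ordK. Qed.

Lemma bitcompl_zeros n : bitcompl (all_zeros n) = all_ones n.
Proof. by apply/ffunP => i; rewrite !ffunE rev_ord2_0. Qed.

(** * Closed form of the outcome amplitudes *)

Section Amplitude.
Variable R : realType.
Local Notation C := R[i].

(** The phase acquired by |y> when Y^{(x) n} maps it to the complementary basis vector. *)
Definition flip_phase n (y : bits n) : C :=
  \prod_(j < n) pauliY R (rev_ord (y j)) (y j).

(* The matrix entry <y| U_1 (x) ... (x) U_n |b...b>. *)
Definition column_prod n (s : profile R n) (y : bits n) (b : 'I_2) : C :=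
  \prod_(j < n) gate (s j) (y j) b.

Lemma pauliY_diag (b : 'I_2) : pauliY R b b = 0.
Proof. by elim/ord2_ind: b; rewrite mxE. Qed.

Lemma tensor_ket_pauliY n (y : bits n) :
  tensor (fun=> pauliY R) *m ket R y = flip_phase y *: ket R (bitcompl y).
Proof.
apply/colP => k; rewrite -[k]enum_valK; move: (enum_val k) => x.
rewrite /ket -colE !mxE eqxx andbT /bits_of !enum_rankK.
rewrite (inj_eq enum_rank_inj).
have [->|/eqP neq_x] := eqVneq x (bitcompl y).
  by rewrite mulr1; apply: eq_bigr => j _; rewrite ffunE.
have /existsP[j /eqP eq_j] : [exists j, x j == y j].
  apply/contraPT: neq_x => /existsPn neq_xy [].
  apply/ffunP => j; rewrite ffunE; have := neq_xy j.
  by elim/ord2_ind: (x j); elim/ord2_ind: (y j); rewrite ?rev_ord2_0 ?rev_ord2_1.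
by rewrite (bigD1 j) //= eq_j pauliY_diag mul0r mulr0.
Qed.

Lemma entangler_ket n (y : bits n) :
  entangler R n *m ket R y =
  ((Num.sqrt 2)^-1)%:C%C *: (ket R y - ('i * flip_phase y) *: ket R (bitcompl y)).
Proof.
by rewrite /entangler -scalemxAl mulmxBl mul1mx -scalemxAl tensor_ket_pauliY scalerA.
Qed.

Lemma braket_tensor n (s : profile R n) (x y : bits n) :
  (ket R x)^T *m tensor (fun j => gate (s j)) *m ket R y =
  (\prod_(j < n) gate (s j) (x j) (y j))%:M.
Proof.
apply/matrixP => i j; rewrite /ket trmx_delta -rowE -colE !ord1 !mxE eqxx mulr1n.
by rewrite /bits_of !enum_rankK.
Qed.

(** Column 0 of the SU(2) identity Y U = conj(U) Y, read entrywise with Y Hermitian. In column 1 the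
    entry of Y on the right is -i instead of i. *)
Lemma gate_flip_col0 (s : strategy R) (a : 'I_2) :
  (pauliY R (rev_ord a) a)^* * gate s (rev_ord a) 0 = 'i * (gate s a 1)^*.
Proof.
elim/ord2_ind: a; rewrite ?rev_ord2_0 ?rev_ord2_1 !mxE /= /expi;
  apply/eqP; rewrite eq_complex /=; apply/andP; split; apply/eqP; rewrite ?cosN ?sinN; ring.
Qed.

Lemma gate_flip_col1 (s : strategy R) (a : 'I_2) :
  (pauliY R (rev_ord a) a)^* * gate s (rev_ord a) 1 = - 'i * (gate s a 0)^*.
Proof.
elim/ord2_ind: a; rewrite ?rev_ord2_0 ?rev_ord2_1 !mxE /= /expi;
  apply/eqP; rewrite eq_complex /=; apply/andP; split; apply/eqP; rewrite ?cosN ?sinN; ring.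
Qed.

Lemma flip_phase_zeros n : flip_phase (all_zeros n) = 'i ^+ n.
Proof.
rewrite /flip_phase (eq_bigr (fun=> 'i)) ?prodr_const ?card_ord // => j _.
by rewrite ffunE rev_ord2_0 mxE.
Qed.

(** The single-qubit identity, multiplied over all qubits, turns entries in the row of the
    complement of [y] into conjugates of entries in the row of [y]. *)
Lemma column_prod_flip n (s : profile R n) (y : bits n) (b c : 'I_2) (k : C) :
    (forall t a, (pauliY R (rev_ord a) a)^* * gate t (rev_ord a) b
                 = k * (gate t a c)^*) ->
  (flip_phase y)^* * column_prod s (bitcompl y) b = k ^+ n * (column_prod s y c)^*.
Proof.
move=> gate_flip; rewrite /column_prod !rmorph_prod -big_split /=.
rewrite -[n in k ^+ n]card_ord -prodr_const -big_split /=.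
by apply: eq_bigr => j _; rewrite ffunE gate_flip.
Qed.

(** J maps |0...0> to (|0...0> - i i^n |1...1>) / sqrt 2, and J|y> is likewise a combination of |y>
    and its complement. Of the four resulting matrix entries, the two in the complementary row are
    conjugates, up to phase, of the other two. *)
Lemma amplitudeE n (s : profile R n) (y : bits n) :
  amplitude s y = (complex.Re (column_prod s y 0))%:C%C
                + 'i ^+ n * (complex.Im (column_prod s y 1))%:C%C.
Proof.
rewrite /amplitude /bra -map_trmx.
(* Reading <y|J^dagger as the adjoint of J|y> lets [entangler_ket] serve at both ends. *)
have adjM m (A : 'M[C]_(m, m)) (v : 'cV[C]_m) :
    map_mx Num.conj v^T *m (map_mx Num.conj A^T) = map_mx Num.conj (A *m v)^T.
  by rewrite trmx_mul map_mxM.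
rewrite map_trmx adjM.
rewrite -mulmxA entangler_ket entangler_ket.
set r := ((Num.sqrt 2)^-1)%:C%C.
have rJ : r^* = r by rewrite /r; apply/eqP; rewrite eq_complex /= oppr0 !eqxx.
have rr : r * r = 2^-1.
  rewrite /r -rmorphM /= -invfM -expr2 sqr_sqrtr ?ler0n //.
  by rewrite fmorphV /= rmorph_nat.
have ketJ (x : bits n) : map_mx Num.conj (ket R x)^T = (ket R x)^T.
  by rewrite /ket trmx_delta map_delta_mx.
have adjZ m a (v : 'cV[C]_m) : map_mx Num.conj (a *: v)^T = a^* *: map_mx Num.conj v^T.
  by apply/matrixP => i j; rewrite !mxE rmorphM.
have adjB m (u v : 'cV[C]_m) :
    map_mx Num.conj (u - v)^T = map_mx Num.conj u^T - map_mx Num.conj v^T.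
  by apply/matrixP => i j; rewrite !mxE rmorphB.
rewrite adjZ adjB adjZ !ketJ rJ.
rewrite -!scalemxAl -scalemxAr scalerA rr !mulmxBl !mulmxBr.
rewrite -!scalemxAl -!scalemxAr !braket_tensor !scale_scalar_mx -!raddfB /=.
rewrite scale_scalar_mx mxE eqxx mulr1n.
have columnE (x z : bits n) b : (forall j, z j = b) ->
    \prod_(j < n) gate (s j) (x j) (z j) = column_prod s x b.
  by move=> zb; apply: eq_bigr => j _; rewrite zb.
rewrite bitcompl_zeros !(columnE _ (all_zeros n) 0) => [|j|j]; rewrite ?ffunE //.
rewrite !(columnE _ (all_ones n) 1) => [|j|j]; rewrite ?ffunE //.
rewrite flip_phase_zeros !rmorphM /= conjCi.
have := column_prod_flip s y (@gate_flip_col0).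
have := column_prod_flip s y (@gate_flip_col1).
set z := column_prod s y 0; set w := column_prod s y 1.
set z' := column_prod s _ 1; set w' := column_prod s _ 0.
set f := (flip_phase y)^* => fz fw.
have ii : 'i * 'i = -1 :> C by rewrite -expr2 sqrCi.
have iin : 'i ^+ n * (- 'i) ^+ n = 1 :> C by rewrite -exprMn mulrN ii opprK expr1n.
(* The phase i^n from J|0...0> cancels the (-i)^n in [fz], so the complementary row contributes
   exactly the conjugates of z and w. *)
transitivity (2^-1 * ((z + z^*) + (- 'i) * 'i ^+ n * (w - w^*))).
  congr (_ * _); rewrite -[- 'i * f * w']mulrA fw.
  have -> : - 'i * f * ('i * 'i ^+ n * z') = - ('i * 'i) * 'i ^+ n * (f * z') by ring.
  rewrite fz ii opprK mul1r [X in _ - (_ - X)](_ : _ = z^*); last by rewrite mulrA iin mul1r.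
  by ring.
rewrite [z + _]addcJ [w - _]subcJ.
have -> : - 'i * 'i ^+ n * (2 * (complex.Im w)%:C%C * 'i)
        = 2 * (- ('i * 'i)) * 'i ^+ n * (complex.Im w)%:C%C :> C by ring.
by rewrite ii opprK mulr1 -mulrA -mulrDr mulKf // pnatr_eq0.
Qed.

End Amplitude.

(** * Outcomes in which all players but one agree *)

Definition point n (i : 'I_n) (a b : 'I_2) : bits n :=
  [ffun j => if j == i then a else b].

Lemma exists_other n (i : 'I_n) : (2 <= n)%N -> exists j, j != i.
Proof.
move=> n_ge2; have : (0 < #|predC1 i|)%N.
  by rewrite cardC1 card_ord -subn1 subn_gt0.
by case/card_gt0P => j ji; exists j.
Qed.

Lemma bitcompl_point n (i : 'I_n) a b :
  bitcompl (point i a b) = point i (rev_ord a) (rev_ord b).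
Proof. by apply/ffunP => j; rewrite !ffunE; case: eqP. Qed.

Lemma wt_point n (i : 'I_n) a b :
  wt (point i a b) = ((a == 1%R) + n.-1 * (b == 1%R))%N.
Proof.
rewrite /wt -sum1_card big_mkcond (bigD1 i) //= inE ffunE eqxx; congr (_ + _)%N.
under eq_bigr => j ji do rewrite inE ffunE (negPf ji).
by rewrite sum_nat_const cardC1 card_ord; case: eqP.
Qed.

(** * Payoff of a single deviator from Q^n *)

Section Deviation.
Variable R : realType.
Local Notation C := R[i].

Lemma expiD (x y : R) : expi (x + y) = expi x * expi y.
Proof. by rewrite /expi cosD sinD [sin x * _ + _]addrC. Qed.

Lemma expiX (x : R) k : expi x ^+ k = expi (k%:R * x).
Proof.
elim: k => [|k IHk]; first by rewrite expr0 mul0r /expi cos0 sin0.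
by rewrite exprS IHk -expiD -{1}[x]mul1r -mulrDl -natr1 [1 + _]addrC.
Qed.

Lemma normcX (z : C) k : Normc.normc (z ^+ k) = Normc.normc z ^+ k.
Proof.
by elim: k => [|k IHk]; rewrite ?expr0 ?Normc.normc1 // !exprS Normc.normcM IHk.
Qed.

Lemma sqr_normc_real (a : R) : Normc.normc a%:C%C ^+ 2 = a ^+ 2.
Proof. by rewrite /= expr0n addr0 sqrtr_sqr real_normK ?num_real. Qed.

Lemma sqr_normc_iX_real k (a : R) : Normc.normc ('i ^+ k * a%:C%C) ^+ 2 = a ^+ 2.
Proof.
rewrite Normc.normcM normcX exprMn sqr_normc_real.
by rewrite /= expr0n expr1n add0r sqrtr1 expr1n expr1n mul1r.
Qed.

Lemma gate_Q n (a b : 'I_2) : a != b -> gate (Qstrat R n) a b = 0.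
Proof.
by elim/ord2_ind: a; elim/ord2_ind: b => //= _; rewrite mxE /= mul0r sin0 ?oppr0.
Qed.

(** The joint phase of the n - 1 players who keep to Q: one share pi/n short of pi. *)
Lemma gate_Q00X n : (0 < n)%N ->
  gate (Qstrat R n) 0 0 ^+ n.-1 = expi (pi - pi / n%:R).
Proof.
move=> n_gt0; rewrite mxE /= mul0r cos0 mulr1 expiX; congr expi.
by rewrite -subn1 natrB // mulrBl mul1r mulrC mulfVK // pnatr_eq0 -lt0n.
Qed.

Lemma gate_Q11X n : (0 < n)%N ->
  gate (Qstrat R n) 1 1 ^+ n.-1 = expi (pi / n%:R - pi).
Proof.
move=> n_gt0; rewrite mxE /= mul0r cos0 mulr1 expiX; congr expi.
rewrite -subn1 natrB // mulrN mulrBl mul1r opprB [n%:R * _]mulrC.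
by rewrite mulfVK // pnatr_eq0 -lt0n.
Qed.

Section Deviate.
Variables (n : nat) (n_ge2 : (2 <= n)%N) (i : 'I_n) (t : strategy R).
Let d := deviate (Qprofile R n) i t.

Lemma column_prod_deviate (y : bits n) c : column_prod d y c =
  gate t (y i) c * \prod_(j < n | j != i) gate (Qstrat R n) (y j) c.
Proof.
rewrite /column_prod (bigD1 i) //= /d /deviate /= eqxx; congr (_ * _).
by apply: eq_bigr => j ji; rewrite (negPf ji).
Qed.

Lemma column_prod_point a b c : column_prod d (point i a b) c =
  gate t a c * ((b == c)%:R * gate (Qstrat R n) c c ^+ n.-1).
Proof.
rewrite column_prod_deviate ffunE eqxx; congr (_ * _).
rewrite (eq_bigr (fun=> gate (Qstrat R n) b c)); last first.
  by move=> j ji; rewrite ffunE (negPf ji).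
rewrite prodr_const cardC1 card_ord.
have [<-|bc] := eqVneq b c; first by rewrite mul1r.
(* Here 0 ^+ n.-1 is 0 and not 1, because n >= 2. *)
by rewrite gate_Q // mul0r expr0n -subn1 subn_eq0 leqNgt n_ge2.
Qed.

Lemma column_prod_not_point (y : bits n) c :
  (forall a b, y != point i a b) -> column_prod d y c = 0.
Proof.
move=> y_notin; rewrite column_prod_deviate.
have /existsP[j /andP[ji yjc]] : [exists j, (j != i) && (y j != c)].
  apply/contraT => /existsPn y_c; case/eqP: (y_notin (y i) c).
  apply/ffunP => j; rewrite ffunE; case: eqP => [-> //|/eqP ji].
  by have := y_c j; rewrite ji negbK => /eqP.
by rewrite (bigD1 j) //= gate_Q // mul0r mulr0.
Qed.

Lemma outcome_prob_not_point (x : bits n) :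
  (forall a b, x != point i a b) -> outcome_prob d x = 0.
Proof.
move=> x_notin; rewrite /outcome_prob amplitudeE !column_prod_not_point.
- by rewrite /= mulr0 addr0 sqr_normc_real expr0n.
- move=> a b; apply: contra_neq (x_notin (rev_ord a) (rev_ord b)).
  by rewrite -bitcompl_point => <-; rewrite bitcomplK.
- move=> a b; apply: contra_neq (x_notin (rev_ord a) (rev_ord b)).
  by rewrite -bitcompl_point => <-; rewrite bitcomplK.
Qed.

(** The measured string is the complement, so the others show 0; the column of |1...1> vanishes and
    only the real part in [amplitudeE] survives. When the others abstain, only the imaginary part
    survives, and its factor i^n has modulus 1. *)
Lemma outcome_prob_others1 a : outcome_prob d (point i a 1) =
  complex.Re (gate t (rev_ord a) 0 * expi (pi - pi / n%:R)) ^+ 2.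
Proof.
rewrite /outcome_prob bitcompl_point amplitudeE !column_prod_point rev_ord2_1.
rewrite mul0r mulr0 /= mulr0 addr0 sqr_normc_real mul1r gate_Q00X //.
exact: ltn_trans n_ge2.
Qed.

Lemma outcome_prob_others0 a : outcome_prob d (point i a 0) =
  complex.Im (gate t (rev_ord a) 1 * expi (pi / n%:R - pi)) ^+ 2.
Proof.
rewrite /outcome_prob bitcompl_point amplitudeE !column_prod_point rev_ord2_0.
rewrite mul0r mulr0 /= add0r sqr_normc_iX_real mul1r gate_Q11X //.
exact: ltn_trans n_ge2.
Qed.

Lemma sum_points (F : bits n -> R) :
    (forall x, (forall a b, x != point i a b) -> F x = 0) ->
  \sum_x F x = F (point i 1 1) + F (point i 0 1) + F (point i 1 0) + F (point i 0 0).
Proof.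
move=> F0; pose p (ab : 'I_2 * 'I_2) := point i ab.1 ab.2.
(* The bit [b] is read off at a second player, who exists since n >= 2. *)
have p_inj : injective p.
  move=> [a b] [a' b'] /ffunP eq_p; have [j ji] := exists_other i n_ge2.
  by have := eq_p i; have := eq_p j; rewrite !ffunE eqxx (negPf ji) /= => -> ->.
transitivity (\sum_(x in p @: [set: _]%SET) F x).
  rewrite [RHS]big_mkcond; apply: eq_bigr => x _; case: ifPn => // x_notin.
  apply: F0 => a b; apply: contraNneq x_notin => ->.
  by apply/imsetP; exists (a, b).
rewrite big_imset /=; last by move=> ? ? _ _; apply: p_inj.
rewrite (eq_bigl predT) => [|ab]; last by rewrite inE.
rewrite -(pair_bigA _ (fun a b => F (point i a b))) /= !big_ord_recl !big_ord0 /=.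
rewrite (_ : lift ord0 ord0 = 1 :> 'I_2); last exact: val_inj.
by rewrite /= !addr0; ring.
Qed.

(** The classical payoffs at the points (1,1), (0,1), (1,0), (0,0) are 2 - 1/n, 2, 1 and 0. The
    first has weight cos^2(theta/2) cos^2(phi - pi/n); the next two share sin^2(theta/2) in the
    ratio cos^2(pi/n) to sin^2(pi/n). *)
Lemma payoff_deviate : payoff i d =
    cos (t.1 / 2) ^+ 2 * (2 - n%:R^-1) * cos (t.2 - pi / n%:R) ^+ 2
  + sin (t.1 / 2) ^+ 2 * (1 + cos (pi / n%:R) ^+ 2).
Proof.
rewrite /payoff sum_points => [|x /outcome_prob_not_point ->]; last exact: mulr0.
rewrite /vd_payoff !wt_point !ffunE eqxx /= muln0 muln1.
rewrite !outcome_prob_others1 !outcome_prob_others0 !rev_ord2_0 !rev_ord2_1.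
have -> : (0 < 0 + n.-1)%N by rewrite add0n -subn1 subn_gt0.
rewrite add1n prednK; last exact: ltn_trans n_ge2.
rewrite addn0 invr1 !mxE /= cosN sinN !cosB !sinB cospi sinpi.
have -> : 1 + cos (pi / n%:R) ^+ 2 = 2 * cos (pi / n%:R) ^+ 2 + sin (pi / n%:R) ^+ 2 :> R.
  by rewrite sin2cos2; ring.
by ring.
Qed.

End Deviate.
End Deviation.

(** * Comparison of sin^2(pi/n) with 1/n *)

Section Trigo.
Variable R : realType.

(** Mean value theorem on [0, x]. Each Taylor bound below is the sign of the derivative needed for
    the next one. *)
Lemma ge0_of_derive_ge0 (f df : R -> R) (x : R) :
    (forall y : R, is_derive y (1 : R) f (df y)) -> (forall y, 0 <= y -> 0 <= df y) ->
  f 0 = 0 -> 0 <= x -> 0 <= f x.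
Proof.
move=> fdf df_ge0 f0 x_ge0.
have [|y] := @MVT_segment R f df 0 x x_ge0 (fun y _ => fdf y).
  apply: continuous_subspaceT => y.
  by apply/differentiable_continuous/derivable1_diffP; apply: ex_derive.
rewrite in_itv /= f0 !subr0 => /andP[y_ge0 _] ->.
by rewrite mulr_ge0 ?df_ge0.
Qed.

Lemma sin_le_id (x : R) : 0 <= x -> sin x <= x.
Proof.
move=> x_ge0; rewrite -subr_ge0.
suff : 0 <= (@id R - sin) x by rewrite !fctE.
apply: (ge0_of_derive_ge0 (df := fun y => 1 - cos y)) => // [y _|].
- by rewrite subr_ge0 cos_le1.
- by rewrite !fctE sin0 subr0.
Qed.

Lemma cos_ge_taylor2 (x : R) : 0 <= x -> 1 - x ^+ 2 / 2 <= cos x.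
Proof.
move=> x_ge0; rewrite -subr_ge0.
suff : 0 <= (cos - cst (1 : R) + 2^-1 \*: ((@id R : R -> R) ^+ 2)) x.
  by rewrite !fctE /= /GRing.scale /=; lra.
apply: (ge0_of_derive_ge0 (df := fun y => y - sin y)) => // [y|y y_ge0|].
- by apply: is_derive_eq; rewrite /GRing.scale /=; lra.
- by rewrite subr_ge0 sin_le_id.
- by rewrite !fctE /= /GRing.scale /= cos0; lra.
Qed.

Lemma sin_ge_taylor3 (x : R) : 0 <= x -> x - x ^+ 3 / 6 <= sin x.
Proof.
move=> x_ge0; rewrite -subr_ge0.
suff : 0 <= (sin - @id R + 6^-1 \*: ((@id R : R -> R) ^+ 3)) x
  by rewrite !fctE /= /GRing.scale /=; lra.
apply: (ge0_of_derive_ge0 (df := fun y => cos y - (1 - y ^+ 2 / 2))) => // [y|y y_ge0|].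
- by apply: is_derive_eq; rewrite /GRing.scale /=; lra.
- by rewrite subr_ge0 cos_ge_taylor2.
- by rewrite !fctE /= /GRing.scale /= sin0; lra.
Qed.

Lemma sin_triple (x : R) : sin (3 * x) = 3 * sin x - 4 * sin x ^+ 3.
Proof.
have -> : 3 * x = x *+ 2 + x by rewrite -mulr_natl; ring.
rewrite sinD sin_mulr2n cos_mulr2n.
transitivity (2 * sin x * cos x ^+ 2 + (2 * cos x ^+ 2 - 1) * sin x); first by ring.
by rewrite cos2sin2; ring.
Qed.

Lemma cos_double (x : R) : cos (2 * x) = 1 - 2 * sin x ^+ 2.
Proof. by rewrite mulr_natl cos_mulr2n cos2sin2; ring. Qed.

Lemma pi_frac_bounds (n : nat) : (2 <= n)%N -> 0 < (pi : R) / n%:R <= pi / 2.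
Proof.
move=> n_ge2; have n_gt0 : (0 < n%:R :> R) by rewrite ltr0n (ltn_trans _ n_ge2).
rewrite divr_gt0 ?pi_gt0 //= ler_wpM2l ?pi_ge0 //.
by rewrite lef_pV2 ?posrE ?ltr0n ?ler_nat // (ltn_trans _ n_ge2).
Qed.

Lemma sin_pi_frac_gt0 (n : nat) : (2 <= n)%N -> 0 < sin (pi / n%:R) :> R.
Proof.
move=> /pi_frac_bounds /andP[gt0 le_half]; apply: sin_gt0_pi; rewrite gt0 /=.
by have := @pi_gt0 R; lra.
Qed.

(** From index 2 on, the angles lie in (0, pi/2], where sin is positive and increasing. *)
Lemma sqr_sin_pi_frac_le (m n : nat) : (2 <= m)%N -> (m <= n)%N ->
  sin (pi / n%:R) ^+ 2 <= sin (pi / m%:R) ^+ 2 :> R.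
Proof.
move=> m_ge2 le_mn; have n_ge2 := leq_trans m_ge2 le_mn.
have pos k : (2 <= k)%N -> sin (pi / k%:R) \is @Num.nneg R.
  by move=> k_ge2; rewrite nnegrE ltW ?sin_pi_frac_gt0.
rewrite ler_sqr ?pos // leNgt ltr_sin.
- rewrite -leNgt ler_wpM2l ?pi_ge0 // lef_pV2 ?posrE ?ltr0n ?ler_nat //.
  + exact: ltn_trans n_ge2.
  + exact: ltn_trans m_ge2.
- by rewrite in_itv /=; have /andP[] := pi_frac_bounds m_ge2; have := @pi_gt0 R; lra.
- by rewrite in_itv /=; have /andP[] := pi_frac_bounds n_ge2; have := @pi_gt0 R; lra.
Qed.

Lemma sin_pi_sixth : sin (pi / 6) = 2^-1 :> R.
Proof.
have := sin_triple (pi / 6); have -> : 3 * (pi / 6) = pi / 2 :> R by lra.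
have := @sin_pi_frac_gt0 6 isT; rewrite sin_pihalf.
set s := sin _ => s_gt0 s3.
(* This factors the triple-angle equation 3s - 4s^3 = 1; the root -1 is excluded by s > 0. *)
have /eqP : (s + 1) * (2 * s - 1) ^+ 2 = 0.
  by rewrite (_ : _ * _ = 1 - (3 * s - 4 * s ^+ 3)); [rewrite -s3 subrr | ring].
by rewrite mulf_eq0 sqrf_eq0 => /orP[] /eqP; lra.
Qed.

Lemma sqr_sin_pi_fourth : sin (pi / 4) ^+ 2 = 2^-1 :> R.
Proof.
have := cos_double (pi / 4); have -> : 2 * (pi / 4) = pi / 2 :> R by lra.
by rewrite cos_pihalf; lra.
Qed.

(** The bound is 1/7 and not 1/8 so that monotonicity also settles n = 7. It amounts to cos(pi/4) <=
    5/7, true because 1/2 < 25/49. *)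
Lemma sqr_sin_pi_eighth_ge : 7^-1 <= sin (pi / 8) ^+ 2 :> R.
Proof.
have := cos_double (pi / 8); have -> : 2 * (pi / 8) = pi / 4 :> R by lra.
have := cos2Dsin2 (pi / 4 : R); rewrite sqr_sin_pi_fourth => c2 c_eq.
suff : cos (pi / 4 : R) <= 5 / 7 by lra.
by nra.
Qed.

Lemma sqr_sin_pi_ninth_ge : 9^-1 <= sin (pi / 9) ^+ 2 :> R.
Proof.
have := sin_triple (pi / 9); have -> : 3 * (pi / 9) = pi / 3 :> R by lra.
have := cos_double (pi / 3); have -> : 2 * (pi / 3) = pi - 2 * (pi / 6) :> R by lra.
rewrite cosB cospi sinpi cos_double sin_pi_sixth => c3 s3.
rewrite s3 in c3; move: c3; have : 0 <= sin (pi / 9 : R) ^+ 2 by exact: sqr_ge0.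
set s := sin _ => S_ge0.
rewrite (_ : (3 * s - 4 * s ^+ 3) ^+ 2 = s ^+ 2 * (3 - 4 * s ^+ 2) ^+ 2); last by ring.
move: (s ^+ 2) S_ge0 => S S_ge0 S_eq; rewrite leNgt; apply/negP => S_lt.
(* S (3 - 4S)^2 = sin^2(pi/3) = 3/4, but the left side increases on [0, 1/4] and is only 529/729 <
   3/4 at S = 1/9. *)
by nra.
Qed.

(** If pi were at least sqrt 10, the cubic lower bound for sin at y = pi/6 would exceed the exact
    value 1/2. *)
Lemma pi_sqr_lt10 : pi ^+ 2 < 10 :> R.
Proof.
rewrite ltNge; apply/negP => pi2_ge10.
have := @sin_ge_taylor3 (pi / 6); rewrite sin_pi_sixth.
have := @pi_gt0 R; have := @pihalf_lt2 R; move: pi2_ge10.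
have [y ->] : exists y, pi = 6 * y :> R by exists (pi / 6); lra.
rewrite (_ : 6 * y / 6 = y); last by lra.
move=> y2 y_lt y_gt0 taylor.
have y3 : y - y ^+ 3 / 6 <= 2^-1 by apply: taylor; lra.
(* 0.527 is just below sqrt 10 / 6. *)
have y_ge : 527 / 1000 <= y by nra.
(* The upper end 2/3 comes from pi < 4. On this interval y - y^3/6 stays above 1/2; the product form
   is a hint for [nra]. *)
have : 0 <= (y - 527 / 1000) * (2 / 3 - y) by rewrite mulr_ge0; lra.
by nra.
Qed.

Lemma sqr_sin_pi_frac_ge (n : nat) : (2 <= n <= 9)%N ->
  n%:R^-1 <= sin (pi / n%:R) ^+ 2 :> R.
Proof.
have s4 := sqr_sin_pi_fourth; have s6 := sin_pi_sixth.
have s8 := sqr_sin_pi_eighth_ge; have s9 := sqr_sin_pi_ninth_ge.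
have le := sqr_sin_pi_frac_le.
case: n => [|[|[|[|[|[|[|[|[|[|//]]]]]]]]]] // _.
(* The case n = 9 is [s9] itself; the remaining cases 2 to 8 borrow from the angles pi/4, pi/6 and
   pi/8. *)
- by have := le 2 4 isT isT; lra.
- by have := le 3 4 isT isT; lra.
- by lra.
- by have := le 5 6 isT isT; rewrite s6; lra.
- by rewrite s6; lra.
- by have := le 7 8 isT isT; lra.
- by lra.
Qed.

(** sin^2(pi/n) <= pi^2/n^2 < 10/n^2 <= 1/n. *)
Lemma sqr_sin_pi_frac_lt (n : nat) : (10 <= n)%N ->
  sin (pi / n%:R) ^+ 2 < n%:R^-1 :> R.
Proof.
move=> n_ge10; have n_ge2 : (2 <= n)%N by apply: leq_trans n_ge10.
have n_gt0 : 0 < n%:R :> R by rewrite ltr0n (ltn_trans _ n_ge2).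
have s_gt0 := sin_pi_frac_gt0 n_ge2; have /andP[a_gt0 _] := pi_frac_bounds n_ge2.
have s_le := sin_le_id (ltW a_gt0).
apply: (@le_lt_trans _ _ ((pi / n%:R) ^+ 2)); first by nra.
rewrite expr_div_n ltr_pdivrMr ?exprn_gt0 // expr2 mulKf ?gt_eqF //.
by apply: lt_le_trans pi_sqr_lt10 _; rewrite ler_nat.
Qed.

End Trigo.

(** * The profile Q^n: outcome, payoff and equilibrium range *)

Section Main.
Variable R : realType.

Lemma wt_all_ones n : wt (all_ones n) = n.
Proof.
by rewrite /wt (eq_card (B := predT)) ?card_ord // => j; rewrite !inE ffunE.
Qed.

Lemma Theta_Q n : (2 <= n)%N -> Theta (Qstrat R n).
Proof.
move=> /(pi_frac_bounds R)/andP[]; rewrite /Theta /Qstrat /=.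
by have := @pi_gt0 R; split; lra.
Qed.

Lemma outcome_prob_Q n (x : bits n) : (2 <= n)%N ->
  outcome_prob (Qprofile R n) x = (x == all_ones n)%:R.
Proof.
move=> n_ge2; have n_gt0 : (0 < n)%N by apply: ltn_trans n_ge2.
have nz : n%:R != 0 :> R by rewrite pnatr_eq0 -lt0n.
(* The n phases pi/n add up to pi or -pi, so both columns are real: the imaginary part in
   [amplitudeE] vanishes and all the weight is on |0...0>, where everyone volunteers. *)
have gateX c : gate (Qstrat R n) c c ^+ n = - 1.
  elim/ord2_ind: c; rewrite mxE /= mul0r cos0 mulr1 expiX ?mulrN mulrC mulfVK //.
    by rewrite /expi cospi sinpi complexr0 rmorphN1.
  by rewrite /expi cosN sinN cospi sinpi oppr0 complexr0 rmorphN1.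
have columnE (y : bits n) c :
    column_prod (Qprofile R n) y c = - (y == [ffun=> c])%:R%:C%C.
  have [->|y_neq] := eqVneq.
    rewrite /column_prod (eq_bigr (fun=> gate (Qstrat R n) c c)) => [|j _].
      by rewrite prodr_const card_ord gateX rmorph1.
    by rewrite ffunE.
  have /existsP[j yjc] : [exists j, y j != c].
    apply: contraNT y_neq => /existsPn y_c; apply/eqP/ffunP => j.
    by rewrite ffunE; have := y_c j; rewrite negbK => /eqP.
  by rewrite /column_prod (bigD1 j) //= gate_Q // mul0r rmorph0 oppr0.
rewrite /outcome_prob amplitudeE !columnE /= oppr0 mulr0 addr0 sqr_normc_real sqrrN.
rewrite (_ : (_ == _) = (x == all_ones n)); first by case: eqP; rewrite ?expr0n ?expr1n.
by rewrite -bitcompl_zeros -(inj_eq (can_inj (@bitcomplK n))) bitcomplK.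
Qed.

Lemma payoff_Q n (a : 'I_n) : (2 <= n)%N -> payoff a (Qprofile R n) = 2 - n%:R^-1.
Proof.
move=> n_ge2; rewrite /payoff (bigD1 (all_ones n)) //= big1 => [|x x_neq].
  by rewrite outcome_prob_Q // eqxx mulr1 addr0 /vd_payoff ffunE eqxx wt_all_ones.
by rewrite outcome_prob_Q // (negPf x_neq) mulr0.
Qed.

Lemma Q_Nash n : (2 <= n <= 9)%N -> is_Nash (Qprofile R n).
Proof.
move=> n29; have /andP[n_ge2 _] := n29.
split=> [i|i t _ _]; first exact: Theta_Q.
rewrite payoff_Q // payoff_deviate //.
have := @sqr_sin_pi_frac_ge R n n29; rewrite sin2cos2.
have : n%:R^-1 <= 1 :> R by rewrite invf_le1 ?ler1n ?ltr0n (ltn_trans _ n_ge2).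
have : 0 <= cos (t.1 / 2) ^+ 2 by exact: sqr_ge0.
have : 0 <= sin (t.1 / 2) ^+ 2 by exact: sqr_ge0.
have := cos2Dsin2 (t.1 / 2).
set D := cos (t.2 - _) ^+ 2; have : D <= 1 by rewrite /D cos2sin2 gerBl sqr_ge0.
move: n%:R^-1 D (sin _ ^+ 2) (cos (pi / _) ^+ 2) (cos (t.1 / _) ^+ 2).
move=> v D B E A D_le1 AB B_ge0 A_ge0 v_le1 v_le.
(* With A + B = 1 the deviator's payoff is an average of (2 - v) D and 1 + E = 2 - sin^2(pi/n),
   neither of which exceeds 2 - v. *)
have AD_le : A * (2 - v) * D <= A * (2 - v) by rewrite ler_piMr ?mulr_ge0 //; lra.
have BE_le : B * (1 + E) <= B * (2 - v) by rewrite ler_wpM2l //; lra.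
apply: le_trans (lerD AD_le BE_le) _.
by rewrite -mulrDl AB mul1r.
Qed.

Lemma Q_not_Nash n : (10 <= n)%N -> ~ is_Nash (Qprofile R n).
Proof.
move=> n_ge10 [_]; have n_ge2 : (2 <= n)%N by apply: leq_trans n_ge10.
have pi_gt0 := @pi_gt0 R.
have i0 : 'I_n by apply: (@Ordinal _ 0); apply: leq_trans n_ge10.
(* At theta = pi the cosine term vanishes and the deviator gets 1 + cos^2(pi/n), whatever phi is. *)
have pi_Theta : Theta (pi, 0 : R) by rewrite /Theta /=; split; lra.
have pi_neq : (pi, 0) <> Qprofile R n i0 by case=> pi0 _; lra.
move=> /(_ i0 _ pi_Theta pi_neq); rewrite payoff_Q // payoff_deviate //=.
have := sqr_sin_pi_frac_lt R n_ge10; rewrite cos_pihalf sin_pihalf sin2cos2.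
by lra.
Qed.

End Main.

Theorem theorem9 (R : realType) (n : nat) (n_ge2 : (2 <= n)%N) :
  [/\ Theta (Qstrat R n),
      forall x : bits n,
        outcome_prob (Qprofile R n) x = (x == all_ones n)%:R,
      forall a : 'I_n, payoff a (Qprofile R n) = 2 - n%:R^-1,
      (n <= 9)%N -> is_Nash (Qprofile R n)
    & (10 <= n)%N -> ~ is_Nash (Qprofile R n)].
Proof.
split.
- exact: Theta_Q.
- by move=> x; apply: outcome_prob_Q.
- by move=> a; apply: payoff_Q.
- by move=> n_le9; apply: Q_Nash; rewrite n_ge2.
- exact: Q_not_Nash.
Qed.
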